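(* Let $X_1,\dots,X_n$ be real observations with periodogram $I_n$, and let $\hat f_n$, $\hat F_n$ and $\tilde f_n$ be defined by $$\hat f_n=\arg\min_{z\in\mathcal{F}}\int_0^\pi(I_n(s)-z(s))^2\,ds,\qquad \hat F_n(t)=\int_0^t\hat f_n(s)\,ds,$$ $$\log\tilde f_n=\arg\min_{z\in\mathcal{F}}\int_0^\pi\{\log I_n(s)+\gamma-z(s)\}^2\,ds,$$ where, for $\tilde f_n$, it is assumed that $\log I_n\in L^2([0,\pi])$. Set $$F_n(t)=\int_0^t I_n(u)\,du,\qquad \tilde F_n(t)=\int_0^t\{\log I_n(u)+\gamma\}\,du,\qquad t\in[0,\pi].$$ Then $$\hat f_n=T(F_n)',\qquad \hat F_n=T(F_n),\qquad \tilde f_n=\exp\{T(\tilde F_n)'\},$$ where the first and third identities are understood up to almost everywhere equality on $(0,\pi]$.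
   Context: $\mathcal{F}$ denotes the convex cone of integrable, monotone nonincreasing functions on $(0,\pi]$, and $\gamma$ is Euler's constant. The periodogram is $I_n(\lambda)=\frac1{2\pi n}\bigl|\sum_{k=1}^nX_ke^{-ik\lambda}\bigr|^2$. For the log-periodogram estimator $\tilde f_n$, $I_n$ may be either this function or its step-function version $t\mapsto I_n(2\pi[nt/2\pi]/n)$, where $[\cdot]$ is the integer part (the same choice being used in the definitions of $\tilde f_n$ and $\tilde F_n$). For a function $h$ on a compact interval $[a,b]$, $T(h)$ denotes its least concave majorant (the smallest concave function $z$ on $[a,b]$ with $z\ge h$), and $T(h)'$ denotes the left derivative of $T(h)$, $T(h)'(t)=\min_{u<t}\max_{v\ge t}\frac{h(v)-h(u)}{v-u}$. Here $[a,b]=[0,\pi]$. *)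

(* Defs.v *)
From HB Require Import structures.
From mathcomp Require Import all_boot all_order all_algebra.
From mathcomp Require Import all_classical all_reals all_analysis.
From mathcomp Require Import measurable_realfun complex.
Import Order.TTheory GRing.Theory Num.Theory.
Import numFieldNormedType.Exports.

Set Implicit Arguments.
Unset Strict Implicit.
Unset Printing Implicit Defensive.

Local Open Scope classical_set_scope.
Local Open Scope ring_scope.

(* exp(- i x) *)
Definition expNi (R : realType) (x : R) : R[i] :=
  Complex (cos x) (- sin x).

(* The observations X_1, ..., X_n are X 0, ..., X (n - 1). *)
Definition periodogram (R : realType) (n : nat) (X : 'I_n -> R) (lambda : R) : R :=
  (2 * pi * n%:R)^-1 *
  ComplexField.Normc.normc
    (\sum_(k < n) (X k)%:C%C * expNi (k.+1%:R * lambda)) ^+ 2.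

Definition step_periodogram (R : realType) (n : nat) (X : 'I_n -> R) (t : R) : R :=
  periodogram X (2 * pi * (Num.floor (n%:R * t / (2 * pi)))%:~R / n%:R).

Definition euler_gamma (R : realType) : R :=
  limn (fun m : nat => \sum_(1 <= k < m.+1) k%:R^-1 - ln (m%:R : R)).

(* lne is the logarithm with lne 0 = -oo, so zeros of I are not hidden by the
   junk value ln 0 = 0. *)
Definition log_per (R : realType) (I : R -> R) (t : R) : \bar R := lne (I t)%:E.

Definition corrected_log_per (R : realType) (I : R -> R) (t : R) : \bar R :=
  (log_per I t + (euler_gamma R)%:E)%E.

Definition square_integrable (R : realType) (D : set R) (g : R -> \bar R) : Prop :=
  measurable_fun D g /\ (Lnorm (@lebesgue_measure R) 2%:E (g \_ D) < +oo)%E.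

(* The members of the cone are extended-real-valued. Integrability and
   monotonicity force the value to be finite on ]0, pi[ and < +oo at pi; the
   value -oo at pi has to be allowed for the log-periodogram projection to exist
   when log I has limit -oo at pi. *)
Definition decr_cone (R : realType) : set (R -> \bar R) :=
  [set z | (@lebesgue_measure R).-integrable `]0, pi] z /\
           forall s t : R, 0 < s -> s <= t -> t <= pi -> (z t <= z s)%E].

Definition sq_dist (R : realType) (g z : R -> \bar R) : \bar R :=
  (\int[@lebesgue_measure R]_(s in `]0%R, pi]) ((g s - z s) ^+ 2))%E.

Definition is_argmin (R : realType) (g f : R -> \bar R) : Prop :=
  decr_cone f /\ forall z, decr_cone z -> (sq_dist g f <= sq_dist g z)%E.

Definition primitive (R : realType) (g : R -> \bar R) (t : R) : R :=
  fine (\int[@lebesgue_measure R]_(s in `]0%R, t]) g s)%E.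

Definition concave_majorant (R : realType) (a b : R) (h z : R -> R) : Prop :=
  convex_function (`[a, b] : set R^o) (fun x => - z x) /\
  forall t, a <= t <= b -> h t <= z t.

Definition is_least_concave_majorant (R : realType) (a b : R) (h z : R -> R) : Prop :=
  concave_majorant a b h z /\
  forall w, concave_majorant a b h w -> forall t, a <= t <= b -> z t <= w t.

(* Only the values on [a, b] are meaningful; see least_concave_majorantP and
   least_concave_majorant_unique below. *)
Definition least_concave_majorant (R : realType) (a b : R) (h : R -> R) : R -> R :=
  xget h [set z | is_least_concave_majorant a b h z].

(* The limit is taken in the extended reals, where it exists at every point of
   ]a, b] for a function that is concave on [a, b]. *)
Definition left_deriv (R : realType) (z : R -> R) (t : R) : \bar R :=
  lim (((z s - z t) / (s - t))%:E @[s --> t^'-]).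

Definition ae_eq_0pi (R : realType) (f g : R -> \bar R) : Prop :=
  {ae @lebesgue_measure R, forall t : R, 0 < t <= pi -> f t = g t}.

Lemma least_concave_majorant_unique (R : realType) (a b : R) (h z w : R -> R) :
  is_least_concave_majorant a b h z -> is_least_concave_majorant a b h w -> forall t, a <= t <= b -> z t = w t.
Proof.
move=> [mz lz] [mw lw] t tab; apply/eqP; rewrite eq_le.
by rewrite (lz _ mw _ tab) (lw _ mz _ tab).
Qed.

Lemma least_concave_majorantP (R : realType) (a b M : R) (h : R -> R) :
  (forall t, a <= t <= b -> h t <= M) -> is_least_concave_majorant a b h (least_concave_majorant a b h).
Proof.
move=> hM.
pose S t := [set w t | w in [set w | concave_majorant a b h w]].
have S0 t : S t !=set0.
  by exists M, (fun=> M) => //; split=> // u x y _ _; rewrite convmm.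
have lbS t : a <= t <= b -> lbound (S t) (h t).
  by move=> tab _ [w [_ hw] <-]; exact: hw.
suff lz : is_least_concave_majorant a b h (fun t => inf (S t)) by exact: (@xgetI _ h _ _ lz).
have zw w : concave_majorant a b h w -> forall t, a <= t <= b -> inf (S t) <= w t.
  by move=> mw t tab; apply: ge_inf; [exists (h t); exact: lbS|exists w].
split=> //; split; last by move=> t tab; apply: lb_le_inf => //; exact: lbS.
move=> u x y; rewrite !inE/= !in_itv/= => xab yab.
rewrite lerNl; apply: lb_le_inf => // _ [w mw <-].
have := mw.1 u x y; rewrite !inE/= !in_itv/= => /(_ xab yab).
rewrite lerNl; apply: le_trans.
rewrite !convRE lerN2.
by apply: lerD; apply: ler_wpM2l; rewrite ?lerN2 ?subr_ge0//; apply: zw.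
Qed.

(* Main.v *)
Require Import Defs.
From mathcomp Require Import all_boot all_order all_algebra.
From mathcomp Require Import all_classical all_reals all_analysis.
From mathcomp Require Import measurable_realfun complex ring lra.
Import Order.TTheory GRing.Theory Num.Theory.
Import numFieldNormedType.Exports.
Local Open Scope classical_set_scope.
Local Open Scope ring_scope.

(** Both halves of the theorem are instances of one statement about isotonic
    regression, [isotonic_regression]: for [g] square-integrable on [0, pi], with
    primitive [G], the nonincreasing function [f] closest to [g] in mean square
    exists, its primitive [F] is the least concave majorant of [G], and
    therefore [f] is almost everywhere the left derivative of that majorant.
    The first half takes for [g] the periodogram, which is continuous; the
    second takes the corrected log-periodogram, and exponentiates.

    Existence ([nearest_point]) is the projection theorem for closed convex sets
    of square-integrable functions: by the parallelogram identity a minimizing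
    sequence chosen fast enough converges almost everywhere, and Fatou's lemma
    shows that the limit is optimal. A limit of nonincreasing functions that
    holds only almost everywhere still has a nonincreasing version, the upper
    limit of the sequence ([nonincr_ae_limit]).

    The identification of [F] rests on first-order optimality. Let
    [u = g - f] be the residual of a minimizer [f]. Optimality says that
    [\int u h <= 0] whenever [f + e h] stays nonincreasing for [0 < e <= 1]
    ([projection_dot_le0]), and two families of directions [h] suffice.
    - The indicator of an initial interval ]0, t] gives [G t <= F t]: [F] lies
      above [G], and it is concave as the integral of a nonincreasing function.
    - If [phi] is nondecreasing and Lipschitz, then both [h = phi \o f] and a
      small negative multiple of it are admissible, hence
      [\int u (phi \o f) = 0]. Letting [phi] tend to the indicator of a half-line
      shows that [u] integrates to zero over each level set where [f > c] or
      [f >= c]. These are initial intervals, so [G = F] at their endpoints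
      ([projection_contact]).

    Given [t], take [c = f t]. On the interval between the two contact points of
    level [c] the function [f] is constant, so [F] is affine there; a concave
    majorant of [G] is above [F] at both ends, hence also at [t]
    ([projection_least_majorant]). Lebesgue differentiation of [F] concludes.

    The argument runs on real-valued functions. A member of the cone is finite on
    ]0, pi[, so it only differs from a real-valued function in the value at [pi];
    conversely a real nonincreasing function on ]0, pi[ becomes a member of the
    cone once it is given the value [-oo] at [pi]. *)

(** * Square-integrable functions *)

Section square_integrable_functions.
Set Implicit Arguments.
Unset Strict Implicit.
Context d (T : measurableType d) (R : realType).
Variables (mu : {measure set T -> \bar R}) (D : set T) (mD : measurable D).
Implicit Types f g h z w : T -> R.

Definition L2fun f :=
  measurable_fun D f /\ mu.-integrable D (EFin \o (fun x => f x ^+ 2)).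

Definition sqnorm f : R := \int[mu]_(x in D) (f x ^+ 2).

Definition dotL2 f g : R := \int[mu]_(x in D) (f x * g x).

Lemma sqnorm_ge0 f : 0 <= sqnorm f.
Proof. by apply: Rintegral_ge0 => x _; exact: sqr_ge0. Qed.

Lemma L2fun_lty f : measurable_fun D f ->
  (\int[mu]_(x in D) (f x ^+ 2)%:E < +oo)%E -> L2fun f.
Proof.
move=> mf foo; split=> //; apply/integrableP; split.
  by apply/measurable_EFinP; exact: measurable_funX.
rewrite (eq_integral (fun x => (f x ^+ 2)%:E))// => x _.
by rewrite /= ger0_norm ?sqr_ge0.
Qed.

(** The pointwise bound [|f g| <= f^2 + g^2] spares the Cauchy-Schwarz inequality. *)
Lemma integrable_mulL2 f g : L2fun f -> L2fun g ->
  mu.-integrable D (EFin \o (fun x => f x * g x)).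
Proof.
move=> [mf If] [mg Ig].
apply: (@le_integrable _ _ _ _ _ mD _
  (fun x => ((f x ^+ 2)%:E + (g x ^+ 2)%:E)%E)).
- by apply/measurable_EFinP; exact: measurable_funM.
- move=> x _ /=; rewrite lee_fin [leRHS]ger0_norm ?addr_ge0 ?sqr_ge0//.
  by rewrite ler_norml; apply/andP; split; nra.
- exact: integrableD.
Qed.

Lemma L2funDZ e f h : L2fun f -> L2fun h -> L2fun (fun x => f x + e * h x).
Proof.
move=> Lf Lh; have [mf If] := Lf; have [mh Ih] := Lh; split.
  by apply: measurable_funD => //; exact: measurable_funM.
apply: (@eq_integrable _ _ _ _ _ mD (fun x =>
   ((f x ^+ 2)%:E + ((2 * e)%:E * (f x * h x)%:E + (e ^+ 2)%:E * (h x ^+ 2)%:E))%E)).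
  by move=> x _ /=; rewrite -!EFinM -!EFinD; congr EFin; ring.
apply: integrableD => //; apply: integrableD => //; apply: integrableZl => //.
exact: integrable_mulL2.
Qed.

Lemma sqnormDZ e f h : L2fun f -> L2fun h ->
  sqnorm (fun x => f x + e * h x) =
    sqnorm f + 2 * e * dotL2 f h + e ^+ 2 * sqnorm h.
Proof.
move=> Lf Lh; rewrite /sqnorm /dotL2.
rewrite (@eq_Rintegral _ _ _ _ _
  (fun x => f x ^+ 2 + (2 * e * (f x * h x) + e ^+ 2 * h x ^+ 2))); last first.
  by move=> x _; ring.
have I1 := integrable_mulL2 Lf Lh.
have I2 : mu.-integrable D (EFin \o (fun x => 2 * e * (f x * h x))).
  by have := integrableZl mD (2 * e) I1; exact: eq_integrable.
have I3 : mu.-integrable D (EFin \o (fun x => e ^+ 2 * h x ^+ 2)).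
  by have := integrableZl mD (e ^+ 2) Lh.2; exact: eq_integrable.
rewrite RintegralD//; [|exact: Lf.2|]; last first.
  by have := integrableD mD I2 I3; exact: eq_integrable.
rewrite RintegralD// RintegralZl// RintegralZl//; first by rewrite addrA.
exact: Lh.2.
Qed.

Lemma eq_L2fun f g : f =1 g -> L2fun f -> L2fun g.
Proof. by move=> /funext ->. Qed.

Lemma L2funB f g : L2fun f -> L2fun g -> L2fun (fun x => f x - g x).
Proof.
move=> Lf Lg; apply: eq_L2fun (L2funDZ (-1) Lf Lg) => x.
by rewrite mulN1r.
Qed.

Lemma L2funM c f : L2fun f -> L2fun (fun x => c * f x).
Proof.
move=> Lf; apply: eq_L2fun (L2funDZ (c - 1) Lf Lf) => x; ring.
Qed.

(** In this form the midpoint of [z] and [w] appears, so that two near-minimizers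
    of the distance to [g] in a convex set are seen to be close to each other. *)
Lemma parallelogram g z w : L2fun g -> L2fun z -> L2fun w ->
  sqnorm (fun x => w x - z x) =
  2 * sqnorm (fun x => g x - z x) + 2 * sqnorm (fun x => g x - w x)
  - 4 * sqnorm (fun x => g x - (z x + w x) / 2).
Proof.
move=> Lg Lz Lw; have Lgz := L2funB Lg Lz; have Lwz := L2funB Lw Lz.
have -> : (fun x => g x - w x) = (fun x => (g x - z x) + (-1) * (w x - z x)).
  by apply/funext => x; ring.
have -> : (fun x => g x - (z x + w x) / 2) =
    (fun x => (g x - z x) + (- 2^-1) * (w x - z x)).
  by apply/funext => x; field.
by rewrite !sqnormDZ//; field.
Qed.

(** First-order optimality: the square norm of [u - e h] is
    [sqnorm u - 2 e <u, h> + e^2 sqnorm h], whose linear term dominates the quadratic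
    one for small [e]. *)
Lemma dotL2_le0 u h : L2fun u -> L2fun h ->
  (forall e, 0 < e -> e <= 1 ->
     sqnorm u <= sqnorm (fun x => u x + (- e) * h x)) ->
  dotL2 u h <= 0.
Proof.
move=> Lu Lh H; rewrite leNgt; apply/negP => uh.
have h0 := sqnorm_ge0 h.
(* With this step size the quadratic term cannot compensate the linear one. *)
pose e := Num.min 1 (dotL2 u h / (1 + sqnorm h)).
have e0 : 0 < e by rewrite lt_min ltr01/= divr_gt0// ltr_pwDl.
have e1 : e <= 1 by rewrite ge_min lexx.
have ed : e * (1 + sqnorm h) <= dotL2 u h.
  by rewrite -ler_pdivlMr ?ltr_pwDl// ge_min lexx orbT.
have := H e e0 e1; rewrite sqnormDZ// sqrrN.
nra.
Qed.

End square_integrable_functions.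

(** * Projection on a convex set of square-integrable functions *)

(** Since [|d| <= 2^-n + 2^n d^2], finiteness of the weighted sum of squares makes
    the increments absolutely summable. *)
Lemma cvgn_weighted_increments (R : realType) (u : R^nat) :
  (\sum_(0 <= n <oo) (2 ^+ n * (u n.+1 - u n) ^+ 2)%:E < +oo)%E -> cvgn u.
Proof.
move=> sfin.
have u0 n : (0 <= (2 ^+ n * (u n.+1 - u n) ^+ 2)%:E)%E.
  by rewrite lee_fin mulr_ge0 ?sqr_ge0 ?exprn_ge0.
have s0 := @nneseries_ge0 _ _ xpredT 0%N (fun n _ _ => u0 n).
set S := (X in (X < _)%E) in sfin s0.
have SE : S = (fine S)%:E by rewrite fineK// ge0_fin_numE.
have : cvgn (series (telescope u)).
  apply: normed_cvg; apply: nondecreasing_is_cvgn.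
    by apply: nondecreasing_series => n _ _; exact: normr_ge0.
  exists (2 + fine S) => _ [n _ <-] /=.
  have le1 : \sum_(0 <= k < n) (2 ^+ k * (u k.+1 - u k) ^+ 2) <= fine S.
    rewrite -lee_fin -SE -sumEFin.
    by apply: nneseries_lim_ge => k _ _; exact: u0.
  have le2 : \sum_(0 <= k < n) (2^-1 ^+ k) <= 2 :> R.
    have := @geometric_seriesE R 1 2^-1.
    move=> /(_ _)/(congr1 (@^~ n)); rewrite /series/= => H.
    under eq_bigr do rewrite -[_ ^+ _]mul1r.
    rewrite H; last by rewrite lt_eqF// invf_lt1// ltr1n.
    have -> : 1 - 2^-1 = 2^-1 :> R by field.
    rewrite mul1r invrK.
    by have : 0 <= 2^-1 ^+ n :> R by []; lra.
  apply: le_trans (lerD le2 le1); rewrite -big_split/=.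
  apply: ler_sum => k _; rewrite exprVn.
  set p : R := 2 ^+ k; have p0 : 0 < p by rewrite exprn_gt0.
  set e := u k.+1 - u k; rewrite -(ler_pM2l p0) mulrDr divff ?gt_eqF//.
  have -> : p * (p * e ^+ 2) = (p * `|e|) ^+ 2.
    by rewrite exprMn real_normK ?num_real// mulrA expr2.
  nra.
move=> /(is_cvgD (is_cvg_cst (u 0%N))).
suff -> : cst (u 0%N) + series (telescope u) = u by [].
by apply/funext => n; rewrite [RHS]eq_sum_telescope.
Qed.

Section nearest_point.
Set Implicit Arguments.
Unset Strict Implicit.
Context d (T : measurableType d) (R : realType).
Variables (mu : {measure set T -> \bar R}) (D : set T) (mD : measurable D).

Lemma minimizing_seq (C : set (T -> R)) (g : T -> R) :
  (exists2 z, C z & L2fun mu D z) ->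
  exists m, exists z_ : nat -> T -> R,
  [/\ forall n, C (z_ n) /\ L2fun mu D (z_ n),
      forall n, sqnorm mu D (fun x => g x - z_ n x) <= m + (4^-1) ^+ n &
      forall z, C z -> L2fun mu D z -> m <= sqnorm mu D (fun x => g x - z x)].
Proof.
move=> [z0 Cz0 Lz0].
pose S := [set sqnorm mu D (fun x => g x - z x) | z in [set z | C z /\ L2fun mu D z]].
have lbS : lbound S 0 by move=> _ [z _ <-]; exact: sqnorm_ge0.
have hS : has_inf S by split; [exists (sqnorm mu D (fun x => g x - z0 x)), z0 |exists 0].
have /choice[z_ zP] : forall n : nat, exists z, [/\ C z, L2fun mu D z &
    sqnorm mu D (fun x => g x - z x) <= inf S + (4^-1) ^+ n].
  move=> n; have e0 : 0 < 4^-1 ^+ n :> R by rewrite exprn_gt0// invr_gt0.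
  by have [_ [z [Cz Lz] <-] /ltW ?] := inf_adherent e0 hS; exists z.
exists (inf S), z_; split.
- by move=> n; have [? ? _] := zP n.
- by move=> n; have [_ _] := zP n.
- by move=> z Cz Lz; apply: ge_inf; [exact: hS.2|exists z].
Qed.

(** Projection on a convex set that is closed under almost everywhere limits. The
    excesses [4^-n] of the minimizing sequence make its increments of square norm
    at most [4 * 4^-n], so that the integral of the sum weighted by [2^n] is
    finite and the sequence converges almost everywhere. *)
Lemma nearest_point (C : set (T -> R)) (g : T -> R) :
  L2fun mu D g -> (exists2 z, C z & L2fun mu D z) ->
  (forall z w, C z -> C w -> C (fun x => (z x + w x) / 2)) ->
  (forall z_ : nat -> T -> R, (forall n, C (z_ n)) ->
     {ae mu, forall x, D x -> cvgn (z_ ^~ x)} ->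
     exists f, [/\ C f, measurable_fun D f &
       {ae mu, forall x, D x -> z_ n x @[n --> \oo] --> f x}]) ->
  exists f, [/\ C f, L2fun mu D f & forall z, C z -> L2fun mu D z ->
    sqnorm mu D (fun x => g x - f x) <= sqnorm mu D (fun x => g x - z x)].
Proof.
move=> Lg C0 Cmid Ccl.
have [m [z_ [zC zm mle]]] := minimizing_seq g C0.
have Lz n := (zC n).2.
have Cz n := (zC n).1.
have incr n : sqnorm mu D (fun x => z_ n.+1 x - z_ n x) <= 4 * 4^-1 ^+ n.
  rewrite (parallelogram mD Lg)//.
  have /(mle _ (Cmid _ _ (Cz n) (Cz n.+1))) mid :
      L2fun mu D (fun x => (z_ n x + z_ n.+1 x) / 2).
    have := L2funM mD 2^-1 (L2funDZ mD 1 (Lz n) (Lz n.+1)).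
    by apply: eq_L2fun => x; rewrite mul1r mulrC.
  have := zm n; have := zm n.+1; rewrite exprS.
  have : 0 <= 4^-1 ^+ n :> R by rewrite exprn_ge0// invr_ge0.
  lra.
have cvgz : {ae mu, forall x, D x -> cvgn (z_ ^~ x)}.
  pose s (n : nat) x := (2 ^+ n * (z_ n.+1 x - z_ n x) ^+ 2)%:E.
  have Ls n := L2funB mD (Lz n.+1) (Lz n).
  have ms n : measurable_fun D (s n).
    apply/measurable_EFinP; apply: measurable_funM => //.
    exact: measurable_funX (Ls n).1.
  have s0 n x : D x -> (0 <= s n x)%E.
    by move=> _; rewrite lee_fin mulr_ge0 ?sqr_ge0 ?exprn_ge0.
  have ints n : (\int[mu]_(x in D) s n x <= (geometric 4 2^-1 n)%:E)%E.
    rewrite /s; under eq_integral do rewrite EFinM.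
    rewrite ge0_integralZl//; last 2 first.
    - by apply/measurable_EFinP; exact: measurable_funX (Ls n).1.
    - by move=> x _; rewrite lee_fin sqr_ge0.
    have -> : (\int[mu]_(x in D) ((z_ n.+1 x - z_ n x) ^+ 2)%:E =
        (sqnorm mu D (fun x => z_ n.+1 x - z_ n x))%:E)%E.
      by rewrite /sqnorm /Rintegral fineK// integrable_fin_num//; exact: (Ls n).2.
    rewrite -EFinM lee_fin /=; apply: (le_trans (ler_wpM2l _ (incr n))).
      by rewrite exprn_ge0.
    by rewrite mulrCA -exprMn; have -> : 2 / 4 = 2^-1 :> R by field.
  have sumfin : (\int[mu]_(x in D) (\sum_(0 <= n <oo) s n x) < +oo)%E.
    rewrite integral_nneseries//.
    apply: (@le_lt_trans _ _ (\sum_(0 <= n <oo) (geometric 4 2^-1 n)%:E)%E).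
      by apply: lee_nneseries => [n _ _|n _]; [apply: integral_ge0 => x; exact: s0|exact: ints].
    have h1 : `|2^-1| < 1 :> R by rewrite ger0_norm// invf_lt1 ?ltr1n.
    rewrite (_ : (\sum_(0 <= n <oo) _)%E = (4 * (1 - 2^-1)^-1)%:E) ?ltry//.
    apply/cvg_lim => //; under eq_fun do rewrite sumEFin.
    apply: cvg_EFin; first exact: nearW.
    exact: (@cvg_geometric_series R 4 2^-1 h1).
  have ssum0 x : D x -> (0 <= \sum_(0 <= n <oo) s n x)%E.
    by move=> Dx; apply: nneseries_ge0 => n _ _; exact: s0.
  have : mu.-integrable D (fun x => (\sum_(0 <= n <oo) s n x)%E).
    apply/integrableP; split.
      by apply: ge0_emeasurable_sum => // n x Dx _; exact: s0.
    rewrite (eq_integral (fun x => (\sum_(0 <= n <oo) s n x)%E))//.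
    by move=> x /[!inE] Dx; rewrite gee0_abs// ssum0.
  move=> /(integrable_ae mD); apply: filterS => x H Dx.
  apply: cvgn_weighted_increments.
  by rewrite -ge0_fin_numE ?H//; exact: ssum0.
have [f [Cf mf zf]] := Ccl _ Cz cvgz.
pose F n x := ((g x - z_ n x) ^+ 2)%:E.
have LF n := L2funB mD Lg (Lz n).
have mF n : measurable_fun D (F n).
  by apply/measurable_EFinP; exact: measurable_funX (LF n).1.
have F0 n x : D x -> (0 <= F n x)%E by rewrite lee_fin sqr_ge0.
have intF n : (\int[mu]_(x in D) F n x =
    (sqnorm mu D (fun x => (g x - z_ n x)%R))%:E)%E.
  by rewrite /sqnorm /Rintegral fineK// integrable_fin_num//; exact: (LF n).2.
have mgf : measurable_fun D (fun x => g x - f x).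
  by apply: measurable_funB => //; exact: Lg.1.
have gf2 : measurable_fun D (fun x => ((g x - f x) ^+ 2)%:E).
  by apply/measurable_EFinP; exact: measurable_funX.
have gfm : (\int[mu]_(x in D) ((g x - f x) ^+ 2)%:E <= m%:E)%E.
  rewrite (@ge0_ae_eq_integral _ _ _ _ _ _ (fun x => limn_einf (F ^~ x)))//.
  - apply: (le_trans (fatou mu mD mF F0)).
    suff : (\int[mu]_(x in D) F n x)%E @[n --> \oo] --> m%:E.
      by move=> /cvg_limn_einf_sup[-> _].
    under eq_fun do rewrite intF; apply: cvg_EFin; first exact: nearW.
    apply: (@squeeze_cvgr _ _ _ _ (cst m) (fun n => m + 4^-1 ^+ n)).
    - by apply: nearW => n; rewrite zm andbT; exact: mle.
    - exact: cvg_cst.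
    - rewrite -[X in _ --> X]addr0; apply: cvgD; first exact: cvg_cst.
      by apply: cvg_expr; rewrite ger0_norm// invf_lt1 ?ltr1n.
  - rewrite (_ : (fun x => _) = (\- (fun x => limn_esup (fun n => - F n x)))%E).
      apply: measurableT_comp => //; apply: measurable_fun_limn_esup => n.
      exact: measurableT_comp.
    apply/funext => x; rewrite -limn_einfN; congr limn_einf.
    by apply/funext => n; rewrite /comp oppeK.
  - by move=> x Dx; rewrite lee_fin sqr_ge0.
  - move=> x Dx; rewrite limn_einf_lim; apply: lime_ge; first exact: is_cvg_einfs.
    by apply: nearW => n; apply: le_ereal_inf_tmp => _ [k _ <-]; exact: F0.
  - apply: filterS zf => x zx Dx; apply/esym.
    suff : F n x @[n --> \oo] --> ((g x - f x) ^+ 2)%:E.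
      by move=> /cvg_limn_einf_sup[-> _].
    apply: cvg_EFin; first exact: nearW.
    have h : g x - z_ n x @[n --> \oo] --> g x - f x.
      by apply: cvgB; [exact: cvg_cst|exact: zx].
    by rewrite expr2; exact: (cvgM h h).
have Lgf : L2fun mu D (fun x => g x - f x).
  by apply: L2fun_lty => //; exact: le_lt_trans gfm (ltry m).
have Lf : L2fun mu D f.
  by apply: eq_L2fun (L2funB mD Lg Lgf) => x; ring.
exists f; split=> // z Cz' Lz'; apply: le_trans (mle _ Cz' Lz').
rewrite -lee_fin; apply: le_trans gfm.
by rewrite /sqnorm /Rintegral fineK// integrable_fin_num//; exact: Lgf.2.
Qed.

End nearest_point.

(** * Nonincreasing functions and their primitives *)

(** Registered as an instance for the filter combinators to act on almost everywhere
    statements for the Lebesgue measure. *)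
Definition ae_lebesgue_filter (R : realType) :=
  ae_filter_ringOfSetsType (@lebesgue_measure R).
#[export] Existing Instance ae_lebesgue_filter.

Section nonincreasing_functions.
Set Implicit Arguments.
Unset Strict Implicit.
Context (R : realType).
Notation mu := (@lebesgue_measure R).
Implicit Types (f g h u z : R -> R) (b c s t x y : R).

(** The endpoint [b] is left out: a member of the cone may take the value [-oo] there,
    which no real number can represent. *)
Definition nonincr b f := forall s t, 0 < s -> s <= t -> t < b -> f t <= f s.

Lemma itv_ae_point (x y : R) (P : R -> Prop) : x < y ->
  {ae mu, forall t, x < t -> t < y -> P t} -> exists t, [/\ x < t, t < y & P t].
Proof.
move=> xy aeP; apply: contrapT => nP.
have : mu.-negligible `]x, y[%classic.
  apply: negligibleS aeP => t /=; rewrite in_itv/= => /andP[xt ty] H.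
  by apply: nP; exists t; split=> //; exact: H.
move=> neg; have : mu `]x, y[%classic = 0%E by exact: measure_negligible.
by rewrite /= lebesgue_measure_itv/= lte_fin xy -EFinB => -[]/eqP; rewrite subr_eq0 gt_eqF.
Qed.

Lemma nonincr_measurable b f : nonincr b f -> measurable_fun `]0, b] f.
Proof.
move=> fni; apply/measurable_fun_itv_bndo_bndcP.
apply: (measurability (@RGenCInfty.G R)) => [|/= _ [_] [r] -> <-].
  exact: RGenCInfty.measurableE.
apply: is_interval_measurable => s t /=.
rewrite !in_itv/= !andbT => -[/andP[s0 sb] rs] [/andP[t0 tb] rt] x /andP[sx xt].
have x0 : 0 < x by exact: lt_le_trans sx.
have xb : x < b by exact: le_lt_trans tb.
by split; rewrite in_itv/= ?x0 ?xb// andbT; apply: (le_trans rt); exact: fni.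
Qed.

Lemma le_limn_esup (u v : (\bar R)^nat) :
  (forall n, u n <= v n)%E -> (limn_esup u <= limn_esup v)%E.
Proof.
move=> uv; rewrite !limn_esup_lim; apply: lee_lim.
- exact: is_cvg_esups.
- exact: is_cvg_esups.
- apply: nearW => n; apply: ge_ereal_sup => _ [k /= nk <-].
  by apply: (le_trans (uv k)); apply: ereal_sup_ubound; exists k.
Qed.

(** The upper limit is nonincreasing at every point. It is finite because each point
    of ]0, b[ lies between two points of convergence. *)
Lemma nonincr_ae_limit b (z_ : nat -> R -> R) : (forall n, nonincr b (z_ n)) ->
  {ae mu, forall x, `]0, b]%classic x -> cvgn (z_ ^~ x)} ->
  exists f, [/\ nonincr b f, measurable_fun `]0, b] f &
    {ae mu, forall x, `]0, b]%classic x -> z_ n x @[n --> \oo] --> f x}].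
Proof.
move=> zni zcvg; pose L x := limn_esup (fun n => (z_ n x)%:E).
have Lcvg x : cvgn (z_ ^~ x) -> L x = (limn (z_ ^~ x))%:E.
  move=> zx; have : (z_ n x)%:E @[n --> \oo] --> (limn (z_ ^~ x))%:E.
    by apply: cvg_EFin => //; exact: nearW.
  by move=> /cvg_limn_einf_sup[_].
have point x y : 0 <= x -> x < y -> y <= b ->
    exists t, [/\ x < t, t < y & cvgn (z_ ^~ t)].
  move=> x0 xy yb; apply: itv_ae_point => //.
  apply: filterS zcvg => t H xt ty; apply: H.
  by rewrite /= in_itv/= (le_lt_trans x0 xt) (le_trans (ltW ty) yb).
have Lfin x : 0 < x -> x < b -> L x \is a fin_num.
  move=> x0 xb; have [s [s0 sx /Lcvg Ls]] := point 0 x (lexx _) x0 (ltW xb).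
  have [t [xt tb /Lcvg Lt]] := point x b (ltW x0) xb (lexx _).
  rewrite fin_numElt; apply/andP; split.
    apply: (@lt_le_trans _ _ (L t)); first by rewrite Lt ltNyr.
    by apply: le_limn_esup => n; rewrite lee_fin zni// ltW.
  apply: (@le_lt_trans _ _ (L s)); last by rewrite Ls ltry.
  by apply: le_limn_esup => n; rewrite lee_fin zni// ltW.
have fni : nonincr b (fine \o L).
  move=> s t s0 st tb; have t0 := lt_le_trans s0 st.
  have sb := le_lt_trans st tb.
  apply: fine_le; rewrite ?Lfin//.
  by apply: le_limn_esup => n; rewrite lee_fin zni.
exists (fine \o L); split=> //; first exact: nonincr_measurable.
by apply: filterS zcvg => x H /H zx; rewrite /= Lcvg.
Qed.

(** A downward closed subset of ]0, b[ is an initial interval; whether it contains its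
    endpoint [a] is left open, being irrelevant to integration. *)
Lemma nonincr_split b (P : R -> bool) : 0 < b ->
  (forall s t, 0 < s -> s <= t -> t < b -> P t -> P s) ->
  exists a, [/\ 0 <= a <= b,
    forall s, 0 < s -> s < b -> s < a -> P s &
    forall s, 0 < s -> s < b -> a < s -> ~~ P s].
Proof.
move=> b0 Pd; pose S := [set s | [/\ 0 < s, s < b & P s]].
have ubS : ubound S b by move=> s [_ /ltW].
have hubS : has_ubound S by exists b.
have Sup s : 0 < s -> s < b -> P s -> s <= sup S.
  by move=> s0 sb Ps; apply: ub_le_sup.
have [S0|/set0P S0] := eqVneq S set0.
  exists 0; split; first by rewrite lexx ltW.
    by move=> s /lt_trans h _ /h; rewrite ltxx.
  move=> s s0 sb _; apply/negP => Ps.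
  by have : S s by []; rewrite S0.
exists (sup S); split.
- apply/andP; split; last exact: ge_sup.
  by have [s [s0 sb Ps]] := S0; apply: (le_trans (ltW s0)); exact: Sup.
- move=> s s0 sb /(sup_gt S0)[t [t0 tb Pt] st].
  by apply: Pd Pt => //; exact: ltW.
- by move=> s s0 sb as_; apply: contraTN as_ => Ps; rewrite -leNgt Sup.
Qed.

Definition cumul h t : R := \int[mu]_(s in `]0, t]) h s.

Lemma cumul0 h : cumul h 0 = 0.
Proof. by rewrite /cumul set_itv_ge ?Rintegral_set0// bnd_simp ltxx. Qed.

Lemma integrable_sub b h x y : mu.-integrable `]0, b] (EFin \o h) ->
  0 <= x -> y <= b -> mu.-integrable `]x, y] (EFin \o h).
Proof.
move=> ih x0 yb; apply: integrableS ih => // s /=.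
by rewrite !in_itv/= => /andP[xs sy]; rewrite (le_lt_trans x0 xs) (le_trans sy).
Qed.

Lemma cumulB b h x y : mu.-integrable `]0, b] (EFin \o h) ->
  0 <= x -> x <= y -> y <= b ->
  cumul h y - cumul h x = \int[mu]_(s in `]x, y[) h s.
Proof.
move=> ih x0 xy yb; rewrite /cumul Rintegral_itvB//=.
- rewrite Rintegral_itv_bndo_bndc//.
  apply: integrableS (integrable_sub ih x0 yb) => //.
  by apply: subset_itvl; rewrite bnd_simp.
- exact: (integrable_sub ih).
Qed.

Lemma integrable_oo b h x y : mu.-integrable `]0, b] (EFin \o h) ->
  0 <= x -> y <= b -> mu.-integrable `]x, y[ (EFin \o h).
Proof.
move=> ih x0 yb; apply: integrableS (integrable_sub ih x0 yb) => //.
by apply: subset_itvl; rewrite bnd_simp.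
Qed.

Lemma Rintegral_cst_oo c x y : x <= y ->
  \int[mu]_(s in `]x, y[) (fun=> c) s = c * (y - x).
Proof.
move=> xy; rewrite Rintegral_cst//= lebesgue_measure_itv/= lte_fin.
by have [_|yx] := ltP x y; rewrite //= (@le_anti _ _ x y) ?xy ?yx// subrr.
Qed.

Lemma integrable_cst_oo c x y : mu.-integrable `]x, y[ (EFin \o (fun=> c)).
Proof.
apply: measurable_bounded_integrable => //.
  rewrite /= lebesgue_measure_itv/=; case: ifPn => // _.
  by rewrite -EFinB ltry.
exact: bounded_cst.
Qed.

Lemma cumul_increment_le b h c x y : mu.-integrable `]0, b] (EFin \o h) ->
  0 <= x -> x <= y -> y <= b -> (forall s, x < s -> s < y -> h s <= c) ->
  cumul h y - cumul h x <= c * (y - x).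
Proof.
move=> ih x0 xy yb hc; rewrite (cumulB ih)// -Rintegral_cst_oo//.
apply: le_Rintegral => //; first exact: (integrable_oo ih).
  exact: integrable_cst_oo.
by move=> s /=; rewrite in_itv/= => /andP[? ?]; exact: hc.
Qed.

Lemma cumul_increment_ge b h c x y : mu.-integrable `]0, b] (EFin \o h) ->
  0 <= x -> x <= y -> y <= b -> (forall s, x < s -> s < y -> c <= h s) ->
  c * (y - x) <= cumul h y - cumul h x.
Proof.
move=> ih x0 xy yb hc; rewrite (cumulB ih)// -Rintegral_cst_oo//.
apply: le_Rintegral => //; last first.
- by move=> s /=; rewrite in_itv/= => /andP[? ?]; exact: hc.
- exact: (integrable_oo ih).
- exact: integrable_cst_oo.
Qed.

(** The value [f p] is a slope of a line supporting the graph of the primitive at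
    [p]. *)
Lemma cumul_chord b f p y : mu.-integrable `]0, b] (EFin \o f) -> nonincr b f ->
  0 < p < b -> 0 <= y <= b -> cumul f y <= cumul f p + f p * (y - p).
Proof.
move=> If fni /andP[p0 pb] /andP[y0 yb]; have [py|yp] := leP p y.
  have := @cumul_increment_le b f (f p) p y If (ltW p0) py yb.
  move=> H; rewrite -lerBlDl; apply: H => s ps sy.
  by apply: fni => //; [exact: ltW|exact: lt_le_trans yb].
have := @cumul_increment_ge b f (f p) y p If y0 (ltW yp) (ltW pb).
have h s : y < s -> s < p -> f p <= f s.
  by move=> ys sp; apply: fni => //; [exact: le_lt_trans ys|exact: ltW].
by move=> /(_ h); lra.
Qed.

(** A convex combination of two distinct points with weights in ]0, 1[ is interior to
    [0, b], where a supporting line exists. *)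
Lemma cumul_concave b f : mu.-integrable `]0, b] (EFin \o f) -> nonincr b f ->
  convex_function (`[0, b] : set R^o) (fun x => - cumul f x).
Proof.
move=> If fni t x y; rewrite !inE/= !in_itv/= => xb yb.
have [->|t0] := eqVneq t 0%:i01; first by rewrite !conv0.
have [->|t1] := eqVneq t 1%:i01; first by rewrite !conv1.
have [->|xy] := eqVneq x y; first by rewrite !convmm.
rewrite !convRE; set r := t%:inum; rewrite /unstable.onem.
have r0 : 0 < r.
  rewrite /r lt_neqAle eq_sym; apply/andP; split; last exact: ge0.
  by apply: contra t0 => /eqP r0; apply/eqP/val_inj.
have r1 : r < 1.
  rewrite /r lt_neqAle; apply/andP; split; last exact: le1.
  by apply: contra t1 => /eqP r1; apply/eqP/val_inj.
set p := (X in cumul f X).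
have pE : p = r * x + (1 - r) * y by [].
have p0b : 0 < p < b.
  have [/andP[x0 xlb] /andP[y0 ylb]] := (xb, yb).
  by have [xlty|ylex|/eqP] := ltgtP x y; [| |rewrite (negbTE xy)]; rewrite pE; nra.
have := cumul_chord If fni p0b xb; have := cumul_chord If fni p0b yb.
have e : r * (f p * (x - p)) + (1 - r) * (f p * (y - p)) = 0 by rewrite pE; ring.
nra.
Qed.

End nonincreasing_functions.

(** * The nonincreasing projection and the least concave majorant *)

Section isotonic_projection.
Set Implicit Arguments.
Unset Strict Implicit.
Context (R : realType) (b : R) (b0 : 0 < b).
Notation mu := (@lebesgue_measure R).
Notation D := (`]0, b]%classic : set R).
Implicit Types (f g h u z : R -> R) (c s t x y : R).

Let mD : (R.-ocitv.-measurable).-sigma.-measurable D.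
Proof. exact: measurable_itv. Qed.

Definition is_projection g f := [/\ nonincr b f, L2fun mu D f &
  forall z, nonincr b z -> L2fun mu D z ->
    sqnorm mu D (fun x => g x - f x) <= sqnorm mu D (fun x => g x - z x)].

Lemma L2fun_bounded h c : measurable_fun D h ->
  (forall x, D x -> `|h x| <= c) -> L2fun mu D h.
Proof.
move=> mh hc; split=> //; apply: measurable_bounded_integrable => //.
- by rewrite /= lebesgue_measure_itv/=; case: ifPn => // _; rewrite -EFinB ltry.
- exact: measurable_funX.
- exists (c ^+ 2); split; first exact: num_real.
  move=> M cM x Dx /=; rewrite normrX; apply: le_trans (ltW cM).
  by rewrite lerXn2r ?nnegrE ?hc// (le_trans _ (hc _ Dx)).
Qed.

Lemma L2fun_cst c : L2fun mu D (fun=> c).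
Proof. by apply: (@L2fun_bounded _ `|c|) => //; exact: measurable_cst. Qed.

Lemma L2_integrable h : L2fun mu D h -> mu.-integrable D (EFin \o h).
Proof.
move=> Lh; have := integrable_mulL2 mD Lh (L2fun_cst 1).
by apply: eq_integrable => // x _; rewrite /= mulr1.
Qed.

Lemma projection_exists g : L2fun mu D g -> exists f, is_projection g f.
Proof.
move=> Lg; have [||z_ zni zcvg|f [fni Lf fmin]] :=
    @nearest_point _ _ _ mu D mD [set z | nonincr b z] g Lg.
- by exists (fun=> 0); [move=> ? ?|exact: L2fun_cst].
- move=> z w zni wni s t s0 st tb /=.
  by rewrite ler_pM2r ?invr_gt0// lerD ?zni ?wni.
- exact: nonincr_ae_limit zcvg.
- by exists f.
Qed.

(** The functions [x |-> ramp (k (x - c))] and [x |-> ramp (1 + k (x - c))] are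
    nondecreasing and Lipschitz, and they converge as [k] grows to the indicators of
    [c < x] and of [c <= x]. *)
Definition ramp x : R := Num.min 1 (Num.max 0 x).

Lemma ramp_itv x : 0 <= ramp x <= 1.
Proof. by rewrite /ramp le_min ler01/= le_max lexx/= ge_min lexx. Qed.

Lemma ramp_lipschitz x y : x <= y -> 0 <= ramp y - ramp x <= y - x.
Proof.
rewrite /ramp => xy; have [x0|x0] := leP 0 x; have [y0|y0] := leP 0 y; try lra.
- by have [x1|x1] := leP 1 x; have [y1|y1] := leP 1 y; lra.
- by have [y1|y1] := leP 1 y; have [h|h] := leP 1 (0 : R); lra.
Qed.

Definition above (strict : bool) c x := if strict then c < x else c <= x.

Lemma above_le (strict : bool) c x y : x <= y -> above strict c x -> above strict c y.
Proof.
by rewrite /above => xy; case: strict => cx; [exact: lt_le_trans xy|exact: le_trans xy].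
Qed.

Lemma ramp_cvg (strict : bool) c x :
  ramp ((~~ strict)%:R + k.+1%:R * (x - c)) @[k --> \oo] --> ((above strict c x)%:R : R).
Proof.
apply: cvg_near_cst; rewrite /above /ramp.
have [xc|cx|->] := ltgtP c x; last first.
- near=> k; rewrite subrr mulr0 addr0.
  by case: strict => /=; rewrite ?maxxx ?(max_r (@ler01 R)) ?minxx// min_r.
- near=> k; have : (c - x)^-1 <= k.+1%:R.
    by rewrite (@le_trans _ _ k%:R) ?ler_nat//; near: k; exact: nbhs_infty_ger.
  rewrite -div1r ler_pdivrMr ?subr_gt0// => h.
  rewrite max_l ?min_r//; first by case: strict.
  by case: strict => /=; lra.
- near=> k; have : (x - c)^-1 <= k.+1%:R.
    by rewrite (@le_trans _ _ k%:R) ?ler_nat//; near: k; exact: nbhs_infty_ger.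
  rewrite -div1r ler_pdivrMr ?subr_gt0// => h.
  rewrite max_r ?min_l//; first by case: strict.
    by case: strict => /=; lra.
  by case: strict => /=; lra.
Unshelve. all: by end_near. Qed.

(** Pairing with the indicator of an initial interval is integration up to its
    endpoint [a], whatever [P] is at the null points [a] and [b]. *)
Lemma dotL2_prefix u (P : R -> bool) a :
  mu.-integrable D (EFin \o u) ->
  mu.-integrable D (EFin \o (fun s => u s * (P s)%:R)) ->
  0 <= a <= b ->
  (forall s, 0 < s -> s < b -> s < a -> P s) ->
  (forall s, 0 < s -> s < b -> a < s -> ~~ P s) ->
  dotL2 mu D u (fun s => (P s)%:R) = cumul u a.
Proof.
move=> Iu IuP /andP[a0 ab] Pa Na.
have := cumulB IuP a0 ab (lexx b).
have -> : \int[mu]_(s in `]a, b[) (u s * (P s)%:R) = 0.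
  rewrite (@eq_Rintegral _ _ _ _ _ (fun=> 0)) ?Rintegral_cst_oo ?mul0r//.
  move=> s /[!inE]/=; rewrite in_itv/= => /andP[as_ sb].
  by rewrite (negbTE (Na _ _ sb as_)) ?mulr0// (le_lt_trans a0).
move=> /eqP; rewrite subr_eq0 => /eqP; rewrite {1}/cumul /dotL2 => ->.
have Ia := integrable_oo IuP (lexx 0) ab.
rewrite /cumul -Rintegral_itv_bndo_bndc// -Rintegral_itv_bndo_bndc; last first.
  exact: integrable_oo Iu (lexx 0) ab.
apply: eq_Rintegral => s /[!inE]/=; rewrite in_itv/= => /andP[s0 sa].
by rewrite Pa ?mulr1// (lt_le_trans sa).
Qed.

Section variational_inequality.
Variables (g f : R -> R).
Hypotheses (Lg : L2fun mu D g) (fP : is_projection g f).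
Let u x := g x - f x.
Let fni : nonincr b f. Proof. by have [] := fP. Qed.
Let Lf : L2fun mu D f. Proof. by have [] := fP. Qed.
Let Lu : L2fun mu D u. Proof. exact: L2funB. Qed.

(** The competitor [f + e h] has residual [u - e h], whose square norm cannot be below
    that of [u]. *)
Lemma projection_dot_le0 h : L2fun mu D h ->
  (forall e, 0 < e -> e <= 1 -> nonincr b (fun x => f x + e * h x)) ->
  dotL2 mu D u h <= 0.
Proof.
move=> Lh hni; apply: dotL2_le0 => // e e0 e1; have [_ _ fmin] := fP.
apply: (le_trans (fmin _ (hni _ e0 e1) (L2funDZ mD e Lf Lh))).
by rewrite le_eqVlt; apply/orP; left; apply/eqP; congr sqnorm; apply/funext => x;
  rewrite /u; ring.
Qed.

(** Composition with [phi] preserves monotonicity, and so does subtracting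
    [(e / k) * phi] for [e <= 1], as [x |-> x - (e / k) * phi x] is nondecreasing.
    Both signs being admissible, the inequality is an equality. *)
Lemma projection_dot_comp (phi : R -> R) (k : R) : 0 < k ->
  (forall x, 0 <= phi x <= 1) ->
  (forall x y, x <= y -> 0 <= phi y - phi x <= k * (y - x)) ->
  L2fun mu D (phi \o f) /\ dotL2 mu D u (phi \o f) = 0.
Proof.
move=> k0 phi01 philip.
have phini : nonincr b (phi \o f).
  by move=> s t s0 st tb; have /andP[+ _] := philip _ _ (fni s0 st tb); rewrite subr_ge0.
have Lphi : L2fun mu D (phi \o f).
  apply: (@L2fun_bounded _ 1); first exact: nonincr_measurable.
  by move=> x _ /=; have /andP[p0 p1] := phi01 (f x); rewrite ger0_norm.
split=> //; apply/eqP; rewrite eq_le; apply/andP; split.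
  apply: projection_dot_le0 => // e e0 e1 s t s0 st tb.
  by apply: lerD; [exact: fni|rewrite ler_pM2l//; exact: phini].
have := @projection_dot_le0 (fun x => - k^-1 * (phi \o f) x) (L2funM mD _ Lphi).
have -> : dotL2 mu D u (fun x => - k^-1 * (phi \o f) x) =
    - k^-1 * dotL2 mu D u (phi \o f).
  rewrite /dotL2 -RintegralZl//; last exact: integrable_mulL2.
  by apply: eq_Rintegral => x _; rewrite mulrCA.
rewrite mulNr oppr_le0 pmulr_rge0 ?invr_gt0//; apply.
move=> e e0 e1 s t s0 st tb /=.
have := fni s0 st tb; set y := f s; set x := f t => xy.
have /andP[p0 p1] := philip _ _ xy.
have : k^-1 * (phi y - phi x) <= y - x by rewrite ler_pdivrMl.
have : 0 <= k^-1 * (phi y - phi x) by rewrite mulr_ge0// invr_ge0 ltW.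
rewrite !mulNr !mulrN; set p := k^-1 * phi y; set q := k^-1 * phi x.
rewrite mulrBr -/p -/q; nra.
Qed.

(** Indicators of half-lines are not Lipschitz: [f - e h] need not be monotone when [h]
    is the indicator of a level set. They are reached as dominated limits of ramps. *)
Lemma projection_dot_above (strict : bool) c :
  mu.-integrable D (EFin \o (fun s => u s * (above strict c (f s))%:R)) /\
  dotL2 mu D u (fun s => (above strict c (f s))%:R) = 0.
Proof.
pose phi (k : nat) x := ramp ((~~ strict)%:R + k.+1%:R * (x - c)).
have phiP k : L2fun mu D (phi k \o f) /\ dotL2 mu D u (phi k \o f) = 0.
  apply: (@projection_dot_comp _ k.+1%:R) => // [x|x y xy]; first exact: ramp_itv.
  rewrite (_ : k.+1%:R * (y - x) = ((~~ strict)%:R + k.+1%:R * (y - c)) -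
    ((~~ strict)%:R + k.+1%:R * (x - c))); last by ring.
  by apply: ramp_lipschitz; rewrite lerD2l ler_wpM2l// lerB.
have mP : measurable_fun D (fun s => (above strict c (f s))%:R : R).
  apply: nonincr_measurable => s t s0 st tb; rewrite ler_nat.
  by case: (boolP (above strict c (f t))) => // /(above_le (fni s0 st tb)) ->.
have Iu := L2_integrable Lu.
have [|||||I _ C] := @dominated_convergence _ _ _ mu D mD
    (fun k x => (u x * (phi k \o f) x)%:E)
    (fun x => (u x * (above strict c (f x))%:R)%:E) (fun x => `|u x|%:E).
- by move=> k; have := measurable_int mu (integrable_mulL2 mD Lu (phiP k).1).
- by apply/measurable_EFinP; apply: measurable_funM => //; exact: Lu.1.
- apply: aeW => x _; apply: cvg_EFin; first exact: nearW.
  apply: cvgM; first exact: cvg_cst.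
  exact: ramp_cvg.
- exact: integrable_norm Iu.
- apply: aeW => x k _ /=; rewrite lee_fin normrM.
  have /andP[r0 r1] := ramp_itv ((~~ strict)%:R + k.+1%:R * (f x - c)).
  by rewrite /phi (ger0_norm r0) ler_piMr.
split=> //; rewrite /dotL2 /Rintegral; set I1 := (\int[_]_(_ in _) _)%E in C *.
suff -> : I1 = 0%E by [].
have C0 : (fun k : nat => \int[mu]_(x in D) (u x * (phi k \o f) x)%:E)%E = (fun=> 0%E).
  apply/funext => k; have [Lk dk] := phiP k.
  have := congr1 EFin dk; rewrite /dotL2 /Rintegral fineK//.
  by apply: integrable_fin_num => //; exact: integrable_mulL2.
rewrite C0 in C; exact: (cvg_unique (@ereal_hausdorff R) C (cvg_cst _)).
Qed.

Lemma projection_cumul_le t : 0 <= t <= b -> cumul u t <= 0.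
Proof.
move=> tb; have pni (e : R) : 0 <= e -> nonincr b (fun s => e * (s <= t)%R%:R).
  move=> e0 x y _ xy _; rewrite ler_wpM2l// ler_nat.
  by case: (leP y t) => // /(le_trans xy) ->.
have Lt : L2fun mu D (fun s => (s <= t)%R%:R).
  apply: (@L2fun_bounded _ 1) => [|x _]; last by case: (x <= t); rewrite ?normr1 ?normr0.
  by apply: nonincr_measurable => x y x0 xy yb; have := pni 1 ler01 x y x0 xy yb; rewrite !mul1r.
rewrite -(@dotL2_prefix _ (fun s => s <= t)) //.
- apply: projection_dot_le0 => // e e0 _ x y x0 xy yb; apply: lerD; first exact: fni.
  exact: pni (ltW e0) _ _ x0 xy yb.
- exact: L2_integrable.
- exact: integrable_mulL2.
- by move=> s _ _ /ltW.
- by move=> s _ _; rewrite -ltNge.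
Qed.

(** Constants are admissible directions with both signs. *)
Lemma projection_cumul_total : cumul u b = 0.
Proof.
have [|x|_ h] := @projection_dot_comp (fun=> 1) 1 ltr01.
- by move=> x; rewrite lexx ler01.
- by move=> y xy; rewrite subrr lexx mul1r subr_ge0.
by rewrite -h; apply: eq_Rintegral => x _; rewrite mulr1.
Qed.

(** At the endpoint of each level set of the projection, the primitive of the data
    touches the primitive of the projection. *)
Lemma projection_contact (strict : bool) c : exists a, [/\ 0 <= a <= b,
  forall s, 0 < s -> s < b -> s < a -> above strict c (f s),
  forall s, 0 < s -> s < b -> a < s -> ~~ above strict c (f s) &
  cumul u a = 0].
Proof.
have [|a [a0b aP aN]] := @nonincr_split R b (above strict c \o f) b0.
  by move=> s t s0 st tb; apply: above_le; exact: fni.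
exists a; split=> //; have [I <-] := projection_dot_above strict c.
by apply/esym/dotL2_prefix => //; exact: L2_integrable.
Qed.

Lemma cumul_residual t : 0 <= t <= b -> cumul u t = cumul g t - cumul f t.
Proof.
move=> /andP[t0 tb]; rewrite /cumul RintegralB//.
  exact: (integrable_sub (L2_integrable Lg)).
exact: (integrable_sub (L2_integrable Lf)).
Qed.

(** The primitive of the projection is affine on the interval where [f] equals [f t],
    and it touches the primitive of [g] at both ends of that interval. A concave
    function that is above it at these ends is above it at [t]. *)
Lemma projection_least_majorant :
  is_least_concave_majorant 0 b (cumul g) (cumul f).
Proof.
have If := L2_integrable Lf.
split.
  split; first exact: cumul_concave.
  move=> t tb; have := projection_cumul_le tb.
  by rewrite cumul_residual// subr_le0.
move=> w [wconc gw] t /andP[t0 tb].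
have touch a : 0 <= a <= b -> cumul u a = 0 -> cumul f a <= w a.
  by move=> ab; rewrite cumul_residual// => /eqP; rewrite subr_eq0 => /eqP <-; exact: gw.
have [t_gt0|] := ltP 0 t; last first.
  move=> tle0; have -> : t = 0 by apply/le_anti; rewrite t0 tle0.
  by apply: touch; rewrite ?cumul0// lexx ltW.
have [t_ltb|] := ltP t b; last first.
  move=> blet; have -> : t = b by apply/le_anti; rewrite blet tb.
  by apply: touch; rewrite ?projection_cumul_total// lexx ltW.
pose c := f t.
(* The interval on which [f] equals [c] runs from [x] to [y]. *)
have [x [/andP[x0 xb] xP xN ux]] := projection_contact true c.
have [y [/andP[y0 yb] yP yN uy]] := projection_contact false c.
have xt : x <= t.
  by rewrite leNgt; apply/negP => /(xP _ t_gt0 t_ltb); rewrite /above /c ltxx.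
have ty : t <= y.
  by rewrite leNgt; apply/negP => /(yN _ t_gt0 t_ltb); rewrite /above /c lexx.
have fc s : x < s -> s < y -> f s = c.
  move=> xs sy; have s0 := le_lt_trans x0 xs; have sb := lt_le_trans sy yb.
  have := xN s s0 sb xs; have := yP s s0 sb sy; rewrite /above -leNgt => h1 h2.
  by apply/le_anti; rewrite h1 h2.
have incr r s : x <= r -> r <= s -> s <= y -> cumul f s - cumul f r = c * (s - r).
  move=> xr rs sy; have r0 := le_trans x0 xr; have sb := le_trans sy yb.
  have fcrs q : r < q -> q < s -> f q = c.
    by move=> rq qs; apply: fc; [exact: le_lt_trans rq|exact: lt_le_trans sy].
  apply/le_anti/andP; split.
    by apply: cumul_increment_le If r0 rs sb _ => q rq qs; rewrite fcrs.
  by apply: cumul_increment_ge If r0 rs sb _ => q rq qs; rewrite fcrs.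
have wx : cumul f x <= w x by apply: touch => //; rewrite x0.
have wy : cumul f y <= w y by apply: touch => //; rewrite y0.
have Fx := incr x t (lexx _) xt ty; have Fy := incr t y xt ty (lexx _).
have [xy|yx] := ltP x y; last first.
  (* Here [x = t = y], and [t] itself is a contact point. *)
  by have -> : t = x; [apply/le_anti; rewrite xt (le_trans ty)|].
pose l := (y - t) / (y - x).
have l01 : 0 <= l <= 1.
  apply/andP; split; first by rewrite divr_ge0 ?subr_ge0// ltW.
  by rewrite /l ler_pdivrMr ?subr_gt0// mul1r lerD2l lerN2.
have := wconc (Itv01 (andP l01).1 (andP l01).2) x y.
rewrite !inE/= !in_itv/= x0 xb y0 yb => /(_ isT isT).
rewrite !convRE/= /unstable.onem.
set q := (X in w X); have -> : q = t.
  have -> : q = l * x + (1 - l) * y by [].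
  by rewrite /l; field; rewrite subr_eq0 gt_eqF.
have /andP[l0 l1] := l01.
have lE : l * (t - x) = (1 - l) * (y - t).
  by rewrite /l; field; rewrite subr_eq0 gt_eqF.
have : l * cumul f x <= l * w x by rewrite ler_wpM2l.
have : (1 - l) * cumul f y <= (1 - l) * w y by rewrite ler_wpM2l// subr_ge0.
have : cumul f t = l * cumul f x + (1 - l) * cumul f y.
  have -> : cumul f x = cumul f t - c * (t - x) by rewrite -Fx; ring.
  have -> : cumul f y = cumul f t + c * (y - t) by rewrite -Fy; ring.
  have : c * (l * (t - x)) = c * ((1 - l) * (y - t)) by rewrite lE.
  lra.
lra.
Qed.

End variational_inequality.
End isotonic_projection.

(** * Left derivatives, and extended-valued functions *)

Section left_derivative.
Set Implicit Arguments.
Unset Strict Implicit.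
Context (R : realType).
Notation mu := (@lebesgue_measure R).

Lemma derivable_left_deriv (F z : R -> R) (t e : R) : 0 < e ->
  (forall s, t - e < s -> s <= t -> z s = F s) -> derivable F t 1 ->
  left_deriv z t = (derive1 F t)%:E.
Proof.
move=> e0 zF; rewrite derive1E /left_deriv => dF; apply/cvg_lim => //.
apply: cvg_EFin; first exact: nearW.
apply/cvgrPdist_lt => d d0.
have /cvgrPdist_lt /(_ d d0) /= := dF; rewrite -/(derive F t 1).
move=> [r /= r0 rP]; near=> s.
have st : s < t by near: s; exact: nbhs_left_lt.
have sr : t - s < r by rewrite ltrBlDl -ltrBlDr; near: s; apply: nbhs_left_gt; rewrite ltrBlDr ltrDl.
have se : t - e < s by near: s; apply: nbhs_left_gt; rewrite ltrBlDr ltrDl.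
have := rP (s - t).
rewrite /= sub0r normrN ltr0_norm ?subr_lt0// opprB => /(_ sr).
rewrite subr_eq0 lt_eqF// => /(_ isT).
rewrite [(s - t) *: 1]mulr1 subrK /= !zF ?(ltW st)// ?ltrBlDr ?ltrDl//.
by rewrite /GRing.scale/= [_^-1 * _]mulrC.
Unshelve. all: by end_near. Qed.

(** Lebesgue differentiation is applied to [f] extended by zero, whose primitive is
    that of [f] up to [b]. *)
Lemma left_deriv_cumul (b : R) (f z : R -> R) :
  mu.-integrable `]0, b] (EFin \o f) ->
  (forall t, 0 <= t <= b -> z t = cumul f t) ->
  {ae mu, forall t, 0 < t -> t < b -> left_deriv z t = (f t)%:E}.
Proof.
move=> If zf; pose f0 := f \_ `]0, b].
have If0 : mu.-integrable setT (EFin \o f0).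
  by move: If; rewrite integrable_mkcond//= restrict_EFin.
have If0y y : mu.-integrable `]0, y] (EFin \o f0).
  by apply: integrableS If0 => //; exact: measurable_itv.
have := FTC1 If0y (integrable_locally_restrict (measurable_itv _) If).
rewrite -[fun y => _]/(cumul f0).
apply: filterS => t H t0 tb; have [|dF F't] := H; first by rewrite lte_fin.
have -> : f t = f0 t by rewrite /f0 patchE mem_set//= in_itv/= t0 ltW.
rewrite -F't; apply: (derivable_left_deriv t0) => // s.
rewrite subrr => s0 st; rewrite zf; last by rewrite (ltW s0) (le_trans st)// ltW.
apply: eq_Rintegral => r /[!inE]/=; rewrite in_itv/= => /andP[r0 rs].
by rewrite /f0 patchE mem_set//= in_itv/= r0 (le_trans rs)// (le_trans st)// ltW.
Qed.

End left_derivative.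

Section cone_of_extended_functions.
Set Implicit Arguments.
Unset Strict Implicit.
Context (R : realType).
Notation mu := (@lebesgue_measure R).
Notation D := (`]0, pi]%classic : set R).
Implicit Types (z f : R -> \bar R) (h : R -> R).

Let mD : (R.-ocitv.-measurable).-sigma.-measurable D.
Proof. exact: measurable_itv. Qed.

(** An infinite value would propagate to one side of [t], that is to a set of positive
    measure, against integrability. *)
Lemma decr_cone_fin_num z t : decr_cone z -> 0 < t -> t < pi -> z t \is a fin_num.
Proof.
move=> [Iz zni] t0 tpi.
have zfin x y : 0 <= x -> x < y -> y <= pi -> exists s, [/\ x < s, s < y & z s \is a fin_num].
  move=> x0 xy ypi; apply: itv_ae_point => //.
  apply: filterS (integrable_ae mD Iz) => s H xs sy; apply: H.
  by rewrite /= in_itv/= (le_lt_trans x0 xs) (le_trans (ltW sy) ypi).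
have [s [s0 st zs]] := zfin 0 t (lexx _) t0 (ltW tpi).
have [r [tr rpi zr]] := zfin t pi (ltW t0) tpi (lexx _).
have l1 := zni s t s0 (ltW st) (ltW tpi).
have l2 := zni t r t0 (ltW tr) (ltW rpi).
move: zs zr; rewrite !fin_numElt => /andP[_ zs] /andP[zr _].
by rewrite (lt_le_trans zr l2) (le_lt_trans l1 zs).
Qed.

Lemma decr_cone_nonincr z : decr_cone z -> nonincr pi (fine \o z).
Proof.
move=> zC s t s0 st tpi; apply: fine_le.
- exact: decr_cone_fin_num (lt_le_trans s0 st) tpi.
- exact: decr_cone_fin_num s0 (le_lt_trans st tpi).
- by have [_] := zC; apply=> //; exact: ltW.
Qed.

Lemma ae_itv_pi (P : R -> Prop) :
  (forall t, 0 < t -> t < pi -> P t) -> {ae mu, forall t, D t -> P t}.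
Proof.
move=> HP; exists [set pi]; split=> //; first exact: lebesgue_measure_set1.
move=> t /= /not_implyP[]; rewrite in_itv/= => /andP[t0 tpi] nP.
apply/eqP; rewrite eq_le tpi /= leNgt; apply/negP => tltpi; exact/nP/HP.
Qed.

Lemma decr_cone_fine z : decr_cone z -> {ae mu, forall t, D t -> z t = (fine (z t))%:E}.
Proof.
by move=> zC; apply: ae_itv_pi => t t0 tpi; rewrite fineK// decr_cone_fin_num.
Qed.

(** The value [-oo] at [pi] keeps the extension nonincreasing whatever [h] does at [pi],
    in particular when [h] is unbounded below near [pi]. *)
Definition extend h t : \bar R := if t < pi then (h t)%:E else -oo%E.

Lemma extend_ae h : {ae mu, forall t, D t -> extend h t = (h t)%:E}.
Proof. by apply: ae_itv_pi => t t0 tpi; rewrite /extend tpi. Qed.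

Lemma extend_measurable h : measurable_fun D h -> measurable_fun D (extend h).
Proof.
move=> mh; apply/emeasurable_fun_itv_bndo_bndcP.
apply: (@eq_measurable_fun _ _ _ _ _ (EFin \o h)).
  by move=> t /[!inE]/=; rewrite in_itv/= => /andP[_ tpi]; rewrite /extend tpi.
by apply/measurable_EFinP; apply/measurable_fun_itv_bndo_bndcP.
Qed.

Lemma extend_cone h : nonincr pi h -> L2fun mu D h -> decr_cone (extend h).
Proof.
move=> hni Lh; split; last first.
  move=> s t s0 st tpi; rewrite /extend; case: ifPn => tp; last exact: leNye.
  by rewrite (le_lt_trans st tp) lee_fin hni.
have me := extend_measurable Lh.1.
have /integrableP[mh hoo] := L2_integrable Lh.
apply/integrableP; split => //.
have aee : {ae mu, forall t, D t -> (`|extend h t| = `|(h t)%:E|)%E}.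
  by apply: filterS (extend_ae h) => t H /H ->.
have -> // : (\int[mu]_(t in D) `|extend h t| = \int[mu]_(t in D) `|(h t)%:E|)%E.
by apply: ae_eq_integral => //; exact: measurableT_comp.
Qed.

Section real_representative.
Variables (g : R -> \bar R) (gr : R -> R).
Hypotheses (mg : measurable_fun D g) (Lgr : L2fun mu D gr).
Hypothesis (ggr : {ae mu, forall t, D t -> g t = (gr t)%:E}).

Lemma sq_dist_real z h : measurable_fun D z -> measurable_fun D h ->
  {ae mu, forall t, D t -> z t = (h t)%:E} ->
  sq_dist g z = (\int[mu]_(t in D) ((gr t - h t) ^+ 2)%:E)%E.
Proof.
move=> mz mh zh; rewrite /sq_dist.
have aee : {ae mu, forall t, D t ->
    ((g t - z t) ^+ 2 = ((gr t - h t) ^+ 2)%:E)%E}.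
  by apply: filterS2 ggr zh => t + + Dt => /(_ Dt) -> /(_ Dt) ->.
apply: ge0_ae_eq_integral => //.
- rewrite (_ : (fun s => _) = (fun s => (g s - z s) * (g s - z s))%E).
    by apply: emeasurable_funM; exact: emeasurable_funB.
  by apply/funext => s; rewrite expe2.
- apply/measurable_EFinP/measurable_funX; apply: measurable_funB => //.
  exact: Lgr.1.
- by move=> x _; rewrite sqre_ge0.
- by move=> x _; rewrite lee_fin sqr_ge0.
Qed.

Lemma sq_dist_sqnorm z h : measurable_fun D z -> L2fun mu D h ->
  {ae mu, forall t, D t -> z t = (h t)%:E} ->
  sq_dist g z = (sqnorm mu D (fun t => gr t - h t))%:E.
Proof.
move=> mz Lh zh; rewrite (sq_dist_real mz Lh.1 zh) /sqnorm /Rintegral fineK//.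
by apply: integrable_fin_num => //; exact: (L2funB mD Lgr Lh).2.
Qed.

(** The data being square-integrable, only square-integrable members of the cone can
    compete: minimizing over integrable functions is minimizing in mean square. *)
Lemma decr_cone_L2 z : decr_cone z -> (sq_dist g z < +oo)%E ->
  L2fun mu D (fine \o z).
Proof.
move=> zC; have mz := measurable_int mu zC.1.
have mfz : measurable_fun D (fine \o z) by apply: nonincr_measurable; exact: decr_cone_nonincr.
rewrite (sq_dist_real mz mfz (decr_cone_fine zC)) => fin.
have Lgz : L2fun mu D (fun t => gr t - fine (z t)).
  by apply: L2fun_lty => //; apply: measurable_funB => //; exact: Lgr.1.
by apply: eq_L2fun (L2funB mD Lgr Lgz) => t /=; ring.
Qed.

Lemma argmin_projection f : is_argmin g f -> is_projection pi gr (fine \o f).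
Proof.
move=> [fC fmin]; have mf := measurable_int mu fC.1.
have real_dist h : nonincr pi h -> L2fun mu D h ->
    sq_dist g (extend h) = (sqnorm mu D (fun t => gr t - h t))%:E.
  move=> hni Lh; apply: sq_dist_sqnorm => //; last exact: extend_ae.
  exact: extend_measurable Lh.1.
have Lf : L2fun mu D (fine \o f).
  apply: decr_cone_L2 => //; have L0 := L2fun_cst pi (0 : R).
  have n0 : nonincr pi (fun=> 0 : R) by [].
  by apply: (le_lt_trans (fmin _ (extend_cone n0 L0))); rewrite real_dist ?ltry.
split=> //; first exact: decr_cone_nonincr.
move=> h hni Lh; have := fmin _ (extend_cone hni Lh).
by rewrite real_dist// (sq_dist_sqnorm mf Lf (decr_cone_fine fC)) lee_fin.
Qed.

Lemma projection_argmin h : is_projection pi gr h -> is_argmin g (extend h).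
Proof.
move=> [hni Lh hmin]; split; first exact: extend_cone.
move=> z zC; have mz := measurable_int mu zC.1.
have [|fin] := leP +oo%E (sq_dist g z); first by rewrite leye_eq => /eqP ->; rewrite leey.
have Lz := decr_cone_L2 zC fin.
rewrite (sq_dist_sqnorm (extend_measurable Lh.1) Lh (extend_ae h)).
rewrite (sq_dist_sqnorm mz Lz (decr_cone_fine zC)) lee_fin.
by apply: hmin => //; exact: decr_cone_nonincr.
Qed.

Lemma primitive_cumul z h t : measurable_fun D z -> measurable_fun D h ->
  {ae mu, forall t, D t -> z t = (h t)%:E} -> t <= pi -> primitive z t = cumul h t.
Proof.
move=> mz mh zh tpi; have sub : `]0, t]%classic `<=` D.
  by apply: subset_itvl; rewrite bnd_simp.
rewrite /primitive /cumul /Rintegral; congr fine.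
have zht : {ae mu, forall s, `]0, t]%classic s -> z s = (h s)%:E}.
  by apply: filterS zh => s H /sub /H.
apply: ae_eq_integral => //.
- exact: measurable_funS mz.
- by apply/measurable_EFinP; exact: measurable_funS mh.
Qed.

(** The bound [f t < +oo] is what allows a minimizer to be written as a logarithm of a
    real-valued function. *)
Theorem isotonic_regression :
  (exists2 f, is_argmin g f & forall t, (f t < +oo)%E) /\
  forall f, is_argmin g f ->
    ae_eq_0pi f (left_deriv (least_concave_majorant 0 pi (primitive g))) /\
    forall t, 0 <= t <= pi ->
      primitive f t = least_concave_majorant 0 pi (primitive g) t.
Proof.
split.
  have [h hP] := projection_exists Lgr.
  exists (extend h); first exact: projection_argmin.
  by move=> t; rewrite /extend; case: ifPn => _; rewrite ?ltry ?ltNyr.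
move=> f fmin; have fP := argmin_projection fmin.
have [fC _] := fmin; have [_ Lf _] := fP.
have GE t : t <= pi -> primitive g t = cumul gr t.
  by apply: primitive_cumul => //; exact: Lgr.1.
have FE t : t <= pi -> primitive f t = cumul (fine \o f) t.
  apply: primitive_cumul => //; [|exact: Lf.1|exact: decr_cone_fine].
  exact: (measurable_int mu fC.1).
have [[conc maj] least] := projection_least_majorant (@pi_gt0 R) Lgr fP.
have lcm : is_least_concave_majorant 0 pi (primitive g) (cumul (fine \o f)).
  split.
    by split=> // t /andP[t0 tpi]; rewrite GE// maj// t0.
  move=> w [wconc gw]; apply: least; split=> // t /andP[t0 tpi].
  by rewrite -GE// gw// t0.
have TE t : 0 <= t <= pi ->
    least_concave_majorant 0 pi (primitive g) t = cumul (fine \o f) t.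
  have lcmT : is_least_concave_majorant 0 pi (primitive g)
      (least_concave_majorant 0 pi (primitive g)) by exact: (@xgetI _ _ _ _ lcm).
  exact: (least_concave_majorant_unique lcmT lcm).
split; last by move=> t tpi; rewrite TE// FE//; case/andP: tpi.
have ld := left_deriv_cumul (L2_integrable Lf) TE.
have npi : {ae mu, forall t, t != pi}.
  exists [set pi]; split=> //; first exact: lebesgue_measure_set1.
  by move=> t /= /negP; rewrite negbK => /eqP.
apply: filterS2 ld npi => t H tnpi /andP[t0 tpi].
have tlt : t < pi by rewrite lt_neqAle tnpi.
by rewrite H// fineK// decr_cone_fin_num.
Qed.

End real_representative.
End cone_of_extended_functions.

(** * The periodogram and its logarithm *)

Section periodogram_data.
Set Implicit Arguments.
Unset Strict Implicit.
Context (R : realType).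
Notation mu := (@lebesgue_measure R).
Notation D := (`]0, pi]%classic : set R).

Let mD : (R.-ocitv.-measurable).-sigma.-measurable D.
Proof. exact: measurable_itv. Qed.

Lemma periodogramE n (X : 'I_n -> R) (l : R) :
  periodogram X l = (2 * pi * n%:R)^-1 *
    ((\sum_(k < n) X k * cos (k.+1%:R * l)) ^+ 2 +
     (\sum_(k < n) X k * - sin (k.+1%:R * l)) ^+ 2).
Proof.
rewrite /periodogram; congr (_ * _).
set S := \sum_(k < n) _ * expNi _; set a := \sum_(k < n) _; set b := \sum_(k < n) _.
have -> : S = Complex a b.
  rewrite /S /a /b; apply: (big_rec3 (fun c s z => z = Complex c s)) => //.
  by move=> k c s z _ ->; rewrite /expNi; apply/eqP; rewrite eq_complex /=;
    apply/andP; split; apply/eqP; ring.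
by rewrite /ComplexField.Normc.normc sqr_sqrtr// addr_ge0 ?sqr_ge0.
Qed.

Lemma continuous_periodogram n (X : 'I_n -> R) : continuous (periodogram X).
Proof.
have -> : periodogram X = (fun l => (2 * pi * n%:R)^-1 *
    ((\sum_(k < n) X k * cos (k.+1%:R * l)) ^+ 2 +
     (\sum_(k < n) X k * - sin (k.+1%:R * l)) ^+ 2)).
  by apply/funext => l; exact: periodogramE.
have cl (k : nat) : continuous (fun l : R => k%:R * l).
  by move=> l; apply: cvgM; [exact: cvg_cst|exact: cvg_id].
have cc : continuous (fun l : R => \sum_(k < n) X k * cos (k.+1%:R * l)).
  move=> l; apply: (@cvg_big _ _ _ _ _ add_continuous) => // k _.
  apply: cvgM; first exact: cvg_cst.
  by apply: (@continuous_comp _ _ _ _ cos); [exact: cl|exact: continuous_cos].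
have cs : continuous (fun l : R => \sum_(k < n) X k * - sin (k.+1%:R * l)).
  move=> l; apply: (@cvg_big _ _ _ _ _ add_continuous) => // k _.
  apply: cvgM; first exact: cvg_cst; apply: cvgN.
  by apply: (@continuous_comp _ _ _ _ sin); [exact: cl|exact: continuous_sin].
move=> l; apply: cvgM; first exact: cvg_cst.
by apply: cvgD; [exact: (cvgM (cc l) (cc l))|exact: (cvgM (cs l) (cs l))].
Qed.

Lemma L2fun_continuous (h : R -> R) : continuous h -> L2fun mu D h.
Proof.
move=> hc; split; first exact: measurable_funTS (continuous_measurable_fun hc).
have : mu.-integrable `[0, pi] (EFin \o (fun x => h x ^+ 2)).
  apply: continuous_compact_integrable; first exact: segment_compact.
  by apply: continuous_subspaceT => x; exact: (cvgM (hc x) (hc x)).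
by apply: integrableS => //; apply: subset_itvr; rewrite bnd_simp.
Qed.

(** Square-integrability forces finiteness almost everywhere, so that [L] can be replaced
    by a real-valued function. *)
Lemma square_integrable_L2 (L : R -> \bar R) : square_integrable `[0, pi] L ->
  [/\ measurable_fun D L, L2fun mu D (fine \o L) &
      {ae mu, forall t, D t -> L t = (fine (L t))%:E}].
Proof.
move=> [mL Loo]; have sub : D `<=` `[0, pi]%classic.
  by apply: subset_itvr; rewrite bnd_simp.
have mLD : measurable_fun D L by exact: measurable_funS mL.
pose L0 := L \_ `[0, pi]; have mL0 : measurable_fun setT L0.
  by apply/(measurable_restrictT _ (measurable_itv _)).
have mp : measurable_fun setT (fun x => `|L0 x| `^ 2)%E.
  apply: (measurableT_comp (measurable_poweR 2)) => //.
  exact: measurableT_comp.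
have poo : (\int[mu]_(x in D) (`|L x| `^ 2) < +oo)%E.
  have := poweR_lty 2 Loo; rewrite poweR_Lnorm//; apply: le_lt_trans.
  have -> : (\int[mu]_(x in D) (`|L x| `^ 2) =
      \int[mu]_(x in D) (`|L0 x| `^ 2))%E.
    by apply: eq_integral => x /[!inE] /sub Dx; rewrite /L0 patchE mem_set.
  by apply: ge0_subset_integral => // x _; exact: poweR_ge0.
have mpD : measurable_fun D (fun x => `|L x| `^ 2)%E.
  by apply: (measurableT_comp (measurable_poweR 2)) => //; exact: measurableT_comp.
have Ip : mu.-integrable D (fun x => `|L x| `^ 2)%E.
  apply/integrableP; split=> //.
  have -> : (\int[mu]_(x in D) `| `|L x| `^ 2 | = \int[mu]_(x in D) (`|L x| `^ 2))%E.
    by apply: eq_integral => x _; rewrite gee0_abs// poweR_ge0.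
  exact: poo.
have Lfin : {ae mu, forall t, D t -> L t = (fine (L t))%:E}.
  apply: filterS (integrable_ae mD Ip) => t H /H.
  by case: (L t) => //=; rewrite pnatr_eq0.
have mfL : measurable_fun D (fine \o L) by exact: measurableT_comp.
split=> //; apply: L2fun_lty => //; apply: le_lt_trans poo.
have aee : {ae mu, forall t, D t -> ((fine (L t) ^+ 2)%:E = `|L t| `^ 2)%E}.
  apply: filterS Lfin => t H /H ->.
  by rewrite /= powR_mulrn// real_normK ?num_real.
have -> // : (\int[mu]_(x in D) (fine (L x) ^+ 2)%:E =
    \int[mu]_(x in D) (`|L x| `^ 2))%E.
apply: ge0_ae_eq_integral => //.
- by apply/measurable_EFinP; exact: measurable_funX.
- by move=> x _; rewrite lee_fin sqr_ge0.
- by move=> x _; exact: poweR_ge0.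
Qed.

End periodogram_data.

Theorem theorem3 (R : realType) (n : nat) (hn : (0 < n)%N) (X : 'I_n -> R) :
  (let I := fun s => (periodogram X s)%:E in
   let Fn := primitive I in
   (exists fhat : R -> \bar R, is_argmin I fhat) /\
   forall fhat : R -> \bar R, is_argmin I fhat ->
     let Fhat := primitive fhat in
     ae_eq_0pi fhat (left_deriv (least_concave_majorant 0 pi Fn)) /\
     (forall t : R, 0 <= t <= pi -> Fhat t = least_concave_majorant 0 pi Fn t))
  /\
  (forall I : R -> R, I = periodogram X \/ I = step_periodogram X ->
   square_integrable `[0, pi] (log_per I) ->
   let Ftilde := primitive (corrected_log_per I) in
   let is_ftilde := fun f : R -> R =>
     (forall t, 0 < t <= pi -> 0 <= f t) /\
     is_argmin (corrected_log_per I) (fun t => lne (f t)%:E) in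
   (exists ftilde : R -> R, is_ftilde ftilde) /\
   forall ftilde : R -> R, is_ftilde ftilde ->
     ae_eq_0pi (fun t => (ftilde t)%:E)
               (fun t => expeR (left_deriv (least_concave_majorant 0 pi Ftilde) t))).
Proof.
split.
  have LI := L2fun_continuous (@continuous_periodogram R n X).
  have mI : measurable_fun `]0, pi] (fun s => (periodogram X s)%:E).
    by apply/measurable_EFinP; exact: LI.1.
  have [|[f fmin _] H] := isotonic_regression mI LI; first exact: aeW.
  by split; [exists f|exact: H].
move=> I _ /square_integrable_L2[mL LL Lfin] Ft is_ft.
pose gr t := fine (log_per I t) + euler_gamma R.
have Lgr : L2fun (@lebesgue_measure R) `]0, pi] gr.
  have mD : (R.-ocitv.-measurable).-sigma.-measurable `]0, pi]%classic.
    exact: measurable_itv.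
  have L1 := L2funDZ mD (euler_gamma R) LL (L2fun_cst pi (1 : R)).
  by apply: eq_L2fun L1 => t; rewrite mulr1.
have mg : measurable_fun `]0, pi] (corrected_log_per I) by exact: emeasurable_funD.
have [|[f fmin foo] H] := isotonic_regression mg Lgr.
  by apply: filterS Lfin => t H /H; rewrite /corrected_log_per => {1}->.
(* A minimizer of the logarithmic problem is turned into an estimator by [expeR],
   which sends the value [-oo] to [0]. *)
have lneK_f : (fun t => lne (fine (expeR (f t)))%:E) = f.
  apply/funext => t; have := foo t; rewrite -[RHS]expeRK.
  by case: (f t).
split.
  exists (fun t => fine (expeR (f t))); split; last by rewrite lneK_f.
  by move=> t _; rewrite fine_ge0// expeR_ge0.
move=> ft [ft0 ftmin]; have [+ _] := H _ ftmin; apply: filterS => t lnft tpi.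
rewrite -(lnft tpi) lneK// in_itv/= leey andbT lee_fin; exact: ft0.
Qed.
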